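(* Let $E,Q\in M_n(\mathbb C)$ be such that $E^TQ$ is skew-symmetric and at least one of $E$ and $Q$ is nonsingular. Then there exist $U,V\in GL_n(\mathbb C)$ and a positive integer $f$ such that $$(UEV,U^{-T}QV)=\bigoplus_{i=1}^{f}(A_i,B_i),$$ where $(A_i,B_i)\in\{(I_2,H_2(-1)),(1,0)\}$ if $E$ is nonsingular, and $(A_i,B_i)\in\{(I_2,H_2(-1)),(0,1)\}$ if $Q$ is nonsingular. This canonical form is uniquely determined by $(E,Q)$ up to permutation of summands.
   Context: $M_n(\mathbb C)$ is the set of $n\times n$ complex matrices, $GL_n(\mathbb C)$ the nonsingular ones, $A^{-T}=(A^{-1})^T$. $H_2(-1)=\begin{bmatrix}0&1\\-1&0\end{bmatrix}$; $(1,0)$ and $(0,1)$ are pairs of $1\times1$ matrices. The direct sum of pairs is $(A,B)\oplus(C,D):=(A\oplus C,B\oplus D)$, where $\oplus$ on matrices is the block-diagonal direct sum. *)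

(* Defs.v *)
From HB Require Import structures.
From mathcomp Require Import all_boot all_order all_algebra.
From mathcomp Require Import reals complex.

Set Implicit Arguments.
Unset Strict Implicit.
Unset Printing Implicit Defensive.

Import Order.TTheory GRing.Theory Num.Theory.
Local Open Scope ring_scope.

(* Pairs of square matrices of a common size; the size is part of the data, so
   that summands of different sizes can be listed together and compared. *)
Definition mxpair (C : comUnitRingType) : Type :=
  {k : nat & ('M[C]_k * 'M[C]_k)%type}.

Definition mkpair (C : comUnitRingType) (k : nat) (A B : 'M[C]_k) : mxpair C :=
  existT (fun k : nat => ('M[C]_k * 'M[C]_k)%type) k (A, B).

Definition pair_dsum (C : comUnitRingType) (f : nat) (s : f.-tuple (mxpair C)) :
    mxpair C :=
  mkpair (\mxdiag_(i < f) (tagged (tnth s i)).1)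
         (\mxdiag_(i < f) (tagged (tnth s i)).2).

Definition H2m1 (C : comUnitRingType) : 'M[C]_2 :=
  block_mx (0 : 'M_1) 1%:M (- 1%:M) (0 : 'M_1).

Definition pair_IH (C : comUnitRingType) : mxpair C := mkpair 1%:M (H2m1 C).
Definition pair_10 (C : comUnitRingType) : mxpair C :=
  mkpair (1%:M : 'M[C]_1) 0.
Definition pair_01 (C : comUnitRingType) : mxpair C :=
  mkpair (0 : 'M[C]_1) 1%:M.

Definition skew_symmetric (C : comUnitRingType) (n : nat) (A : 'M[C]_n) : Prop :=
  A^T = - A.

Definition pair_canonical_form (C : comUnitRingType) (n : nat) (E Q : 'M[C]_n)
    (f : nat) (s : f.-tuple (mxpair C)) : Prop :=
  [/\ (0 < f)%N,
      E \in unitmx ->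
        forall i : 'I_f, tnth s i = pair_IH C \/ tnth s i = pair_10 C,
      Q \in unitmx ->
        forall i : 'I_f, tnth s i = pair_IH C \/ tnth s i = pair_01 C
    & exists U V : 'M[C]_n,
        [/\ U \in unitmx, V \in unitmx
          & mkpair (U *m E *m V) ((invmx U)^T *m Q *m V) = pair_dsum s]].

(* Main.v *)
Require Import Defs.
From Stdlib Require Import FunctionalExtensionality.
From HB Require Import structures.
From mathcomp Require Import all_boot all_order all_algebra.
From mathcomp Require Import perm reals complex.

Set Implicit Arguments.
Unset Strict Implicit.
Unset Printing Implicit Defensive.

Import Order.TTheory GRing.Theory Num.Theory.
Local Open Scope ring_scope.
Local Open Scope complex_scope.

(** The equivalence (E, Q) -> (UEV, U^-T Q V) turns K = E^T Q into V^T K V, and a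
    nonsingular E (or Q) lets one recover U from V and the target pair. So it
    suffices to bring the skew-symmetric matrix K by congruence to the form A^T B
    with (A, B) a direct sum of canonical pairs: pivot on a nonzero entry of the
    first row, which splits off a block H_2(-1) = I_2^T H_2(-1), or, if that row
    vanishes, split off a zero, which is both 1^T 0 and 0^T 1. For uniqueness,
    n = 2a + b and the rank 2a of the possibly singular matrix determine the
    number a of 2x2 summands and the number b of 1x1 summands. *)

(** Since [F] vanishes at [q], its sum gives the multiplicity of [p]; once that is known, the sum of
    [G] gives the multiplicity of [q]. *)
Lemma perm_eq_two_valued (T : eqType) (p q : T) (F G : T -> nat) (s t : seq T) :
    (0 < F p)%N -> F q = 0%N -> (0 < G q)%N ->
    (forall x, x \in s -> x = p \/ x = q) ->
    (forall x, x \in t -> x = p \/ x = q) ->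
    (\sum_(x <- s) F x = \sum_(x <- t) F x)%N ->
    (\sum_(x <- s) G x = \sum_(x <- t) G x)%N ->
  perm_eq s t.
Proof.
move=> Fp Fq Gq sP tP eqF eqG.
have pq : p != q by apply: contraTneq Fp => ->; rewrite Fq.
have sumE (H : T -> nat) u : (forall x, x \in u -> x = p \/ x = q) ->
    (\sum_(x <- u) H x = count_mem p u * H p + count_mem q u * H q)%N.
  elim: u => [|x u IHu] uP; first by rewrite big_nil.
  rewrite big_cons /= IHu; last by move=> y yu; apply: uP; rewrite in_cons yu orbT.
  have [->|->] := uP x (mem_head x u).
    by rewrite eqxx (negPf pq) !mulnDl mul1n mul0n add0n addnA.
  by rewrite eqxx eq_sym (negPf pq) !mulnDl mul1n mul0n add0n addnCA.
have eqp : count_mem p s = count_mem p t.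
  move/eqP: eqF; rewrite (sumE _ _ sP) (sumE _ _ tP) Fq !muln0 !addn0.
  by rewrite eqn_pmul2r // => /eqP.
have eqq : count_mem q s = count_mem q t.
  move/eqP: eqG; rewrite (sumE _ _ sP) (sumE _ _ tP) eqp eqn_add2l.
  by rewrite eqn_pmul2r // => /eqP.
apply/allP => x; rewrite mem_cat => /orP[/sP|/tP] [->|->] /=;
  by rewrite (eqp, eqq).
Qed.

Lemma sum_leq_eq (T : Type) (r k : T -> nat) (s : seq T) :
    (forall x, (r x <= k x)%N) ->
  ((\sum_(x <- s) r x)%N == (\sum_(x <- s) k x)%N) = all (fun x => r x == k x) s.
Proof.
move=> le; elim: s => [|x s IHs] /=; first by rewrite !big_nil.
have les : (\sum_(y <- s) r y <= \sum_(y <- s) k y)%N.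
  by apply: leq_sum => y _; apply: le.
rewrite !big_cons -IHs.
exact: (leqif_add (leqif_eq (le x)) (leqif_eq les)).2.
Qed.

Section Congruence.
Variable F : fieldType.

(** * Size, rank and nonsingularity of direct sums of pairs *)

Lemma mkpair_cast (m n : nat) (e : m = n) (A B : 'M[F]_m) :
  mkpair (castmx (e, e) A) (castmx (e, e) B) = mkpair A B.
Proof. by case: n / e; rewrite !castmx_id. Qed.

Lemma pair_dsum_cons (f k m : nat) (A B : 'M[F]_k) (C D : 'M[F]_m)
    (s : f.-tuple (mxpair F)) :
    mkpair C D = pair_dsum s ->
  mkpair (block_mx A 0 0 C) (block_mx B 0 0 D) =
    pair_dsum [tuple of mkpair A B :: s].
Proof.
move=> eqs; set s' := [tuple of _].
rewrite [RHS]/pair_dsum !mxdiag_recl mkpair_cast.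
(* The block sizes depend on the summands, so the entries cannot be rewritten in isolation. Both
   sides are written as one function of the whole family of summands, and only the families are
   compared. *)
pose Phi (p : mxpair F) := mkpair (block_mx A 0 0 (tagged p).1)
                                  (block_mx B 0 0 (tagged p).2).
pose Sum (g : 'I_f -> mxpair F) := mkpair (\mxdiag_(i < f) (tagged (g i)).1)
                                        (\mxdiag_(i < f) (tagged (g i)).2).
transitivity (Phi (Sum (tnth s))); first exact: (congr1 Phi eqs).
transitivity (Phi (Sum (fun i => tnth s' (lift ord0 i)))); last by [].
by congr (Phi (Sum _)); apply: functional_extensionality => i; rewrite tnthS.
Qed.

Lemma pair_dsum_size (f n : nat) (A B : 'M[F]_n) (s : f.-tuple (mxpair F)) :
  mkpair A B = pair_dsum s -> n = (\sum_(x <- s) tag x)%N.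
Proof. by move/(congr1 (@tag _ _)); rewrite big_tuple. Qed.

Lemma pair_dsum_rank (f n : nat) (A B : 'M[F]_n) (s : f.-tuple (mxpair F)) :
    mkpair A B = pair_dsum s ->
  \rank A = (\sum_(x <- s) \rank (tagged x).1)%N /\
  \rank B = (\sum_(x <- s) \rank (tagged x).2)%N.
Proof.
move=> eqs; rewrite !big_tuple -!rank_mxdiag; split.
  exact: (congr1 (fun x : mxpair F => \rank (tagged x).1) eqs).
exact: (congr1 (fun x : mxpair F => \rank (tagged x).2) eqs).
Qed.

(** Nonsingular means that the rank equals the size. Both are additive over summands and the rank
    never exceeds the size, so equality of the sums forces equality in each summand. *)
Lemma pair_dsum_unit1 (f n : nat) (A B : 'M[F]_n) (s : f.-tuple (mxpair F)) :
    mkpair A B = pair_dsum s ->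
  A \in unitmx <-> forall x, x \in (s : seq _) -> (tagged x).1 \in unitmx.
Proof.
move=> eqs; rewrite -row_free_unit /row_free.
have [-> _] := pair_dsum_rank eqs; rewrite [X in _ == X](pair_dsum_size eqs).
rewrite sum_leq_eq => [|x]; last exact: rank_leq_row.
by split=> [/allP sP x /sP|sP]; last apply/allP => x /sP; rewrite -row_free_unit.
Qed.

Lemma pair_dsum_unit2 (f n : nat) (A B : 'M[F]_n) (s : f.-tuple (mxpair F)) :
    mkpair A B = pair_dsum s ->
  B \in unitmx <-> forall x, x \in (s : seq _) -> (tagged x).2 \in unitmx.
Proof.
move=> eqs; rewrite -row_free_unit /row_free.
have [_ ->] := pair_dsum_rank eqs; rewrite [X in _ == X](pair_dsum_size eqs).
rewrite sum_leq_eq => [|x]; last exact: rank_leq_row.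
by split=> [/allP sP x /sP|sP]; last apply/allP => x /sP; rewrite -row_free_unit.
Qed.

Lemma H2m1_unit : H2m1 F \in unitmx.
Proof.
suff /mulmx1_unit[] : H2m1 F *m (- H2m1 F) = 1%:M by [].
rewrite mulmxN /H2m1 (@mulmx_block _ 1 1 1 1 1 1).
rewrite !(mul0mx, mulmx0, mul1mx, mulmx1, add0r, addr0).
by rewrite (@opp_block_mx _ 1 1 1 1) !oppr0 !opprK -scalar_mx_block.
Qed.

(** * Congruence of skew-symmetric matrices *)

Lemma skew_diag0 (n : nat) (K : 'M[F]_n) (i : 'I_n) :
  (2 : F) != 0 -> K^T = - K -> K i i = 0.
Proof.
move=> F2 /matrixP/(_ i i); rewrite !mxE => /eqP.
by rewrite -addr_eq0 -mulr2n -mulr_natl mulf_eq0 (negPf F2) => /eqP.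
Qed.

Lemma skew_congr (n : nat) (K V : 'M[F]_n) :
  K^T = - K -> (V^T *m K *m V)^T = - (V^T *m K *m V).
Proof. by move=> Ks; rewrite !trmx_mul trmxK Ks mulNmx mulmxN mulmxA. Qed.

Lemma skew_2x2 (P : 'M[F]_2) : (2 : F) != 0 -> P^T = - P ->
  P = P ord0 (lift ord0 ord0) *: H2m1 F.
Proof.
move=> F2 Ps; apply/matrixP => i j; rewrite !mxE.
have P10 : P (lift ord0 ord0) ord0 = - P ord0 (lift ord0 ord0).
  by move/matrixP/(_ ord0 (lift ord0 ord0)): Ps; rewrite !mxE.
(* The entries of [H2m1] are read through the splitting 2 = 1 + 1; [lo] and [hi] turn the two halves
   back into the indices 0 and 1. *)
have lo (k : 'I_2) (l : 'I_1) : k = l :> nat -> k = ord0.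
  by move=> kl; apply: ord_inj; rewrite kl (ord1 l).
have hi (k : 'I_2) (l : 'I_1) : k = (1 + l)%N :> nat -> k = lift ord0 ord0.
  by move=> kl; apply: ord_inj; rewrite kl (ord1 l).
case: splitP => i' ei; rewrite !mxE; case: splitP => j' ej; rewrite !mxE ?ord1.
- by rewrite (lo _ _ ei) (lo _ _ ej) skew_diag0 ?mulr0.
- by rewrite (lo _ _ ei) (hi _ _ ej) mulr1.
- by rewrite (hi _ _ ei) (lo _ _ ej) P10 mulrN1.
- by rewrite (hi _ _ ei) (hi _ _ ej) skew_diag0 ?mulr0.
Qed.

(* [K'] is the Schur complement of the pivot block [P]. *)
Lemma skew_split (m p : nat) (P : 'M[F]_m) (X : 'M[F]_(m, p)) (Z : 'M[F]_(p, m))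
    (Y : 'M[F]_p) (K := block_mx P X Z Y) :
    K^T = - K -> P \in unitmx ->
  exists (V : 'M[F]_(m + p)) (K' : 'M[F]_p),
    [/\ V \in unitmx, K'^T = - K' &
        V^T *m K *m V = block_mx P 0 0 K'].
Proof.
rewrite /K tr_block_mx opp_block_mx => /eq_block_mx[Ps Zt Xt Yt] Pu.
have Pt : (invmx P)^T = - invmx P.
  have PtP : (invmx P)^T *m P = - 1%:M.
    by rewrite -[P in _ *m P]opprK -Ps mulmxN -trmx_mul mulmxV ?trmx1.
  by rewrite -[LHS](mulmxK Pu) PtP mulNmx mul1mx.
(* Right multiplication by this matrix clears [X]. As [Z] is minus the transpose of [X] and
   [invmx P] is skew, its transpose on the left clears [Z]. *)
exists (block_mx 1%:M (- (invmx P *m X)) 0 1%:M), (Y - Z *m invmx P *m X).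
split=> //.
- by rewrite unitmxE det_ublock !det1 mul1r unitr1.
- rewrite [LHS]linearB /= !trmx_mul Yt Zt Xt Pt opprB addrC.
  by rewrite !(mulNmx, mulmxN) !opprK mulmxA.
rewrite tr_block_mx !trmx1 trmx0 !mulmx_block.
rewrite !(mul0mx, mulmx0, mul1mx, mulmx1, add0r, addr0).
rewrite [(- _)^T]linearN /= trmx_mul Pt Xt.
have -> : - (- Z *m - invmx P) *m P + Z = 0.
  by rewrite !(mulNmx, mulmxN) !opprK mulmxKV // addNr.
rewrite !(mulNmx, mulmxN) !opprK mulmxA mulmxV // mul1mx addNr.
by rewrite mul0mx oppr0 add0r addrC.
Qed.

(** Congruence by diag(x, y) multiplies the off-diagonal entries by xy, so diag(1/c, 1) normalizes
    the pivot. *)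
Lemma H2m1_scale (c : F) : c != 0 ->
  exists2 D : 'M[F]_2, D \in unitmx & D^T *m (c *: H2m1 F) *m D = H2m1 F.
Proof.
move=> c0; exists (block_mx (c^-1%:M : 'M_1) (0 : 'M_1) (0 : 'M_1) 1%:M).
  rewrite unitmxE (@det_ublock _ 1 1) det1 det_scalar mulr1 expr1.
  by rewrite unitfE invr_neq0.
rewrite (@tr_block_mx _ 1 1 1 1) /H2m1 (@scale_block_mx _ 1 1 1 1).
rewrite !(@mulmx_block _ 1 1 1 1 1 1) !trmx0 trmx1 tr_scalar_mx !scaler0.
rewrite !(mul0mx, mulmx0, mul1mx, mulmx1, add0r, addr0) scalerN.
by rewrite mulNmx -scalemxAr -scalemxAl mulmx1 mul1mx !scale_scalar_mx divff.
Qed.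

(** The 1x1 summand [p] is a parameter, so that one induction serves both [pair_10] and [pair_01].
    The list may be empty, which lets the induction start at size 0. *)
Definition congr_form (p : mxpair F) (n : nat) (K : 'M[F]_n) : Prop :=
  exists (f : nat) (s : f.-tuple (mxpair F)) (A B V : 'M[F]_n),
    [/\ forall x, x \in (s : seq _) -> x = pair_IH F \/ x = p,
        mkpair A B = pair_dsum s, V \in unitmx & V^T *m K *m V = A^T *m B].

Lemma congr_form_mul (p : mxpair F) (n : nat) (K V : 'M[F]_n) :
  V \in unitmx -> congr_form p (V^T *m K *m V) -> congr_form p K.
Proof.
move=> Vu [f [s [A [B [W [sP eqs Wu eqK]]]]]].
exists f, s, A, B, (V *m W); split=> //; first by rewrite unitmx_mul Vu.
by rewrite -eqK trmx_mul !mulmxA.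
Qed.

Lemma congr_form_cons (p : mxpair F) (k m : nat) (a b : 'M[F]_k) (K : 'M[F]_m) :
    mkpair a b = pair_IH F \/ mkpair a b = p -> congr_form p K ->
  congr_form p (block_mx (a^T *m b) 0 0 K).
Proof.
move=> abP [f [s [A [B [V [sP eqs Vu eqK]]]]]].
exists f.+1, [tuple of mkpair a b :: s], (block_mx a 0 0 A), (block_mx b 0 0 B).
exists (block_mx 1%:M 0 0 V); split.
- by move=> x; rewrite in_cons => /predU1P[->|/sP].
- exact: pair_dsum_cons.
- by rewrite unitmxE det_ublock det1 mul1r -unitmxE.
- rewrite !tr_block_mx !mulmx_block !trmx0 trmx1.
  by rewrite !(mul0mx, mulmx0, addr0, add0r, mul1mx, mulmx1) eqK.
Qed.

Lemma congr_form_size0 (p : mxpair F) (K : 'M[F]_0) : congr_form p K.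
Proof.
exists 0%N, [tuple], 0, 0, 1%:M; split=> //; last by rewrite !flatmx0.
  (* The size of the empty direct sum is an empty sum; the pair is destructed so that this size can
     be replaced by 0 in the types of its matrices. *)
  have: tag (pair_dsum ([tuple] : 0.-tuple (mxpair F))) = 0%N by rewrite /= big_ord0.
  case: (pair_dsum _) => k [A B] /= k0; rewrite k0 in A B *.
  by rewrite (flatmx0 A) (flatmx0 B).
by rewrite unitmx1.
Qed.

Lemma skew_congr_form (a b : 'M[F]_1) (n : nat) (K : 'M[F]_n) :
    (2 : F) != 0 -> a^T *m b = 0 -> K^T = - K ->
  congr_form (mkpair a b) K.
Proof.
move=> F2 ab0; elim/ltn_ind: n K => -[|m] IHm K Ks; first exact: congr_form_size0.
(* By skewness a vanishing first row makes the first column vanish; the corner 0 is then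
   [a^T *m b]. *)
have [row0|] := boolP [forall j, K ord0 j == 0].
  have {}row0 j : K ord0 j = 0 by apply/eqP/(forallP row0).
  pose K1 : 'M[F]_(1 + m) := K.
  have ul : ulsubmx K1 = 0 by apply/matrixP=> i j; rewrite !mxE ord1 lshift0 row0.
  have ur : ursubmx K1 = 0 by apply/matrixP=> i j; rewrite !mxE ord1 lshift0 row0.
  have : K1^T = - K1 by [].
  rewrite -[K1]submxK tr_block_mx opp_block_mx => /eq_block_mx[_ dlE _ drs].
  have dl : dlsubmx K1 = 0 by rewrite -[LHS]trmxK dlE ur oppr0 trmx0.
  have KE : K = block_mx (a^T *m b) 0 0 (drsubmx K1).
    by rewrite -[LHS](@submxK _ 1 m 1 m) ul ur dl ab0.
  rewrite KE; apply: (@congr_form_cons _ 1 m); first by right.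
  exact: IHm.
rewrite negb_forall => /existsP[j Kj0].
case: m IHm K Ks j Kj0 => [|m] IHm K Ks j Kj0.
  by move: Kj0; rewrite (ord1 j) skew_diag0 ?eqxx.
(* The transposition of [j] and 1 moves the pivot to position (0, 1). It fixes 0, because the
   diagonal entry is zero and hence [j] is not 0. *)
pose e1 : 'I_m.+2 := lift ord0 ord0.
pose T := tperm_mx j e1 : 'M[F]_m.+2.
pose K1 : 'M[F]_(2 + m) := T^T *m K *m T.
have K101 : K1 ord0 e1 = K ord0 j.
  rewrite /K1 tr_tperm_mx -xcolE -xrowE !mxE tpermR tpermD //.
  by apply: contraNneq Kj0 => ->; rewrite skew_diag0.
apply: (@congr_form_mul _ _ _ T); first exact: unitmx_perm.
rewrite -/K1 -[K1](@submxK _ 2 m 2 m); set P := ulsubmx K1.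
have : K1^T = - K1 by exact: skew_congr.
rewrite -{1 2}[K1](@submxK _ 2 m 2 m) => Ks'.
have Ps : P^T = - P.
  by move: Ks'; rewrite tr_block_mx opp_block_mx => /eq_block_mx[].
have PE : P = K ord0 j *: H2m1 F.
  rewrite {1}(skew_2x2 F2 Ps); congr (_ *: _); rewrite -K101 mxE mxE.
  by congr (K1 _ _); apply: ord_inj.
have Pu : P \in unitmx by rewrite PE unitmxZ ?unitfE ?H2m1_unit.
have [V [K2 [Vu K2s KV]]] := skew_split Ks' Pu.
apply: (congr_form_mul Vu); rewrite KV -/P PE.
have [D Du DE] := H2m1_scale Kj0.
apply: (@congr_form_mul _ _ _ (block_mx D 0 0 1%:M)).
  by rewrite unitmxE det_ublock det1 mulr1 -unitmxE.
rewrite tr_block_mx !mulmx_block trmx0 trmx0 trmx1.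
rewrite !(mul0mx, mulmx0, addr0, add0r, mul1mx, mulmx1) DE.
(* The leading block becomes the product [1%:M^T *m H2m1 F] attached to [pair_IH]; the remaining
   block is smaller by two, hence the strong induction. *)
rewrite -[H2m1 F]mul1mx -trmx1; apply: congr_form_cons; first by left.
by apply: IHm => //; rewrite ltnS leqnSn.
Qed.

End Congruence.

(** * Existence and uniqueness of the canonical form *)

(** The first equation forces [U]. The second follows by cancelling [A^T], which is the transpose of
    [U *m E *m V], so that [U^T] meets [(invmx U)^T]. *)
Lemma equiv_of_congr (F : fieldType) (n : nat) (E Q V A B : 'M[F]_n) :
    E \in unitmx -> A \in unitmx -> V \in unitmx ->
    V^T *m (E^T *m Q) *m V = A^T *m B ->
  exists2 U, U \in unitmx & U *m E *m V = A /\ (invmx U)^T *m Q *m V = B.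
Proof.
move=> Eu Au Vu eqK; pose U := A *m invmx V *m invmx E.
have Uu : U \in unitmx by rewrite !unitmx_mul Au !unitmx_inv Vu.
have UEV : U *m E *m V = A by rewrite mulmxKV // mulmxKV.
exists U => //; split=> //.
move: U Uu UEV => U Uu UEV.
have Atu : A^T \in unitmx by rewrite unitmx_tr.
rewrite -[RHS](mulKmx Atu) -eqK -[LHS](mulKmx Atu) -{2}UEV !trmx_mul -!mulmxA.
by rewrite (mulmxA U^T) -trmx_mul mulVmx // trmx1 mul1mx.
Qed.

Lemma canonical_rank (F : fieldType) (n : nat) (E Q : 'M[F]_n) (f : nat)
    (s : f.-tuple (mxpair F)) :
    pair_canonical_form E Q s ->
  [/\ n = (\sum_(x <- s) tag x)%N,
      \rank E = (\sum_(x <- s) \rank (tagged x).1)%N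
    & \rank Q = (\sum_(x <- s) \rank (tagged x).2)%N].
Proof.
case=> _ _ _ [U [V [Uu Vu eqs]]]; have [<- <-] := pair_dsum_rank eqs.
have Uu' : (invmx U)^T \in unitmx by rewrite unitmx_tr unitmx_inv.
split; first exact: pair_dsum_size eqs.
  by rewrite mxrankMfree ?row_free_unit // eqmxMfull ?row_full_unit.
by rewrite mxrankMfree ?row_free_unit // eqmxMfull ?row_full_unit.
Qed.

Lemma canonical_exists (F : fieldType) (n : nat) (E Q : 'M[F]_n) :
    (2 : F) != 0 -> (0 < n)%N -> skew_symmetric (E^T *m Q) ->
    E \in unitmx \/ Q \in unitmx ->
  exists (f : nat) (s : f.-tuple (mxpair F)), pair_canonical_form E Q s.
Proof.
move=> F2 n0 Ks EQu.
have f_gt0 f (s : f.-tuple (mxpair F)) (A B : 'M[F]_n) :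
    mkpair A B = pair_dsum s -> (0 < f)%N.
  move/pair_dsum_size; case: f s => // s; rewrite tuple0 big_nil => n_eq0.
  by rewrite n_eq0 in n0.
have not_unit0 : (0 : 'M[F]_1) \notin unitmx by rewrite unitmxE det0 unitr0.
have [Eu|Enu] := boolP (E \in unitmx).
  have [f [s [A [B [V [sP eqs Vu eqK]]]]]] :
      congr_form (pair_10 F) (E^T *m Q).
    by apply: skew_congr_form; rewrite ?mulmx0.
  have Au : A \in unitmx.
    by apply/(pair_dsum_unit1 eqs) => x /sP[|] ->; apply: unitmx1.
  have [U Uu [UEV UQV]] := equiv_of_congr Eu Au Vu eqK.
  exists f, s; split; first exact: f_gt0 eqs.
  - by move=> _ i; apply/sP/mem_tnth.
  (* If [Q] is nonsingular as well, so is [B], which excludes the summand [pair_10]: every summand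
     is [pair_IH]. *)
  - move=> Qu i; have /sP[|si] := mem_tnth i s; first by left.
    have /(pair_dsum_unit2 eqs)/(_ _ (mem_tnth i s)) : B \in unitmx.
      by rewrite -UQV !unitmx_mul unitmx_tr unitmx_inv Uu Qu.
    by rewrite si => /= u; rewrite u in not_unit0.
  - by exists U, V; rewrite UEV UQV.
have Qu : Q \in unitmx by case: EQu Enu => // ->.
have [f [s [A [B [V [sP eqs Vu eqK]]]]]] : congr_form (pair_01 F) (E^T *m Q).
  by apply: skew_congr_form; rewrite ?trmx0 ?mul0mx.
have Bu : B \in unitmx.
  by apply/(pair_dsum_unit2 eqs) => x /sP[|] ->; rewrite ?H2m1_unit ?unitmx1.
(* Transposition exchanges the roles of [E] and [Q]. The matrix [U] found for the exchanged pair
   acts on [Q], so [(invmx U)^T] is the one that acts on [E]. *)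
have eqKt : V^T *m (Q^T *m E) *m V = B^T *m A.
  by apply: trmx_inj; rewrite !trmx_mul !trmxK -eqK !mulmxA.
have [U Uu [UQV UEV]] := equiv_of_congr Qu Bu Vu eqKt.
exists f, s; split; first exact: f_gt0 eqs.
- by move=> Eu; rewrite Eu in Enu.
- by move=> _ i; apply/sP/mem_tnth.
- exists (invmx U)^T, V; rewrite unitmx_tr unitmx_inv trmx_inv invmxK trmxK.
  by rewrite -trmx_inv UEV UQV.
Qed.

Lemma canonical_unique (F : fieldType) (n : nat) (E Q : 'M[F]_n) (f g : nat)
    (s : f.-tuple (mxpair F)) (t : g.-tuple (mxpair F)) :
    E \in unitmx \/ Q \in unitmx ->
  pair_canonical_form E Q s -> pair_canonical_form E Q t -> perm_eq s t.
Proof.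
move=> EQu cs ct; have [sn sE sQ] := canonical_rank cs.
have [tn tE tQ] := canonical_rank ct.
have rkH : \rank (H2m1 F) = 2%N by rewrite mxrank_unit ?H2m1_unit.
case: EQu => [Eu|Qu].
  (* The second components have rank 2 in [pair_IH] and 0 in [pair_10], so the rank of [Q] counts
     the former and the size [n] then the latter. *)
  apply: (@perm_eq_two_valued _ (pair_IH F) (pair_10 F)
            (fun x => \rank (tagged x).2) (fun x => tag x)) => //=.
  - by rewrite rkH.
  - by rewrite mxrank0.
  - by move=> x /tnthP[i ->]; case: cs => _ /(_ Eu).
  - by move=> x /tnthP[i ->]; case: ct => _ /(_ Eu).
  - by rewrite -sQ.
  - by rewrite -sn.
apply: (@perm_eq_two_valued _ (pair_IH F) (pair_01 F)
          (fun x => \rank (tagged x).1) (fun x => tag x)) => //=.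
- by rewrite mxrank1.
- by rewrite mxrank0.
- by move=> x /tnthP[i ->]; case: cs => _ _ /(_ Qu).
- by move=> x /tnthP[i ->]; case: ct => _ _ /(_ Qu).
- by rewrite -sE.
- by rewrite -sn.
Qed.

Theorem theorem3p7 (R : realType) (n : nat) (E Q : 'M[R[i]]_n)
    (n_gt0 : (0 < n)%N)
    (skewEQ : skew_symmetric (E^T *m Q))
    (unitEQ : E \in unitmx \/ Q \in unitmx) :
  (exists (f : nat) (s : f.-tuple (mxpair R[i])), pair_canonical_form E Q s) /\
  (forall (f g : nat) (s : f.-tuple (mxpair R[i])) (t : g.-tuple (mxpair R[i])),
     pair_canonical_form E Q s -> pair_canonical_form E Q t -> perm_eq s t).
Proof.
split; last by move=> f g s t; apply: canonical_unique.
by apply: canonical_exists => //; rewrite pnatr_eq0.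
Qed.
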